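(* Let $n,m$ be positive integers and let $A$ be an arbitrary $n\times m$ binary matrix. Then: (a) If $s\ge 1$ and $X_1,\dots,X_s\in\mathcal{T}_n$ are such that $r(X_1X_2\cdots X_sA)<r(X_2X_3\cdots X_sA)<\dots<r(X_sA)<r(A)$, then $c(X_1X_2\cdots X_sA)<c(A)$. (b) If $t\ge 1$ and $Y_1,\dots,Y_t\in\mathcal{T}_m$ are such that $c(AY_1Y_2\cdots Y_t)<c(AY_2Y_3\cdots Y_t)<\dots<c(AY_t)<c(A)$, then $r(AY_1Y_2\cdots Y_t)<r(A)$.
   Context: A binary matrix is a matrix with entries in $\{0,1\}$. For an $n\times m$ binary matrix $A=[a_{ij}]$, let $r(A)=\langle x_1,\dots,x_n\rangle$ where $x_i$ is the natural number whose binary representation is $a_{i1}a_{i2}\cdots a_{im}$ (so $a_{i1}$ is the most significant bit), and let $c(A)=\langle y_1,\dots,y_m\rangle$ where $y_j$ is the natural number whose binary representation is $a_{1j}a_{2j}\cdots a_{nj}$ (so $a_{1j}$ is the most significant bit). The symbol $<$ between such tuples denotes the (strict) lexicographic order on ordered tuples of integers of the same length. $\mathcal{T}_k$ denotes the set of $k\times k$ transposition matrices, i.e. permutation matrices obtained from the identity by swapping exactly two rows; multiplying a matrix on the left by an element of $\mathcal{T}_n$ swaps exactly two of its rows, and multiplying on the right by an element of $\mathcal{T}_m$ swaps exactly two of its columns. *)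

(* Defs.v *)
From mathcomp Require Import all_boot all_order all_fingroup all_algebra.

Set Implicit Arguments.
Unset Strict Implicit.
Unset Printing Implicit Defensive.

Import Order.TTheory GRing.Theory.
Local Open Scope ring_scope.

(* The entries live in the semiring nat, so that products with transposition
   matrices are ordinary matrix products. *)
Definition binary_mx n m (A : 'M[nat]_(n, m)) : Prop :=
  forall i j, A i j = 0%N \/ A i j = 1%N.

(* The number written a_0 a_1 ... a_(k-1) in base 2, most significant bit
   first. *)
Definition bin_value k (a : 'I_k -> nat) : nat :=
  (\sum_(l < k) a l * 2 ^ (k - l.+1))%N.

(* The type n.-tuplelexi nat carries the lexicographic order. *)
Definition row_code n m (A : 'M[nat]_(n, m)) : n.-tuplelexi nat :=
  [tuple bin_value (fun j => A i j) | i < n].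

Definition col_code n m (A : 'M[nat]_(n, m)) : m.-tuplelexi nat :=
  [tuple bin_value (fun i => A i j) | j < m].

Definition is_transposition_mx k (X : 'M[nat]_k) : Prop :=
  exists i j : 'I_k, i != j /\ X = tperm_mx i j.

(* Main.v *)
(* A transposition that lowers r(A) exchanges two rows p < q with x_q < x_p.
   At the first column l where these rows differ, row p has 1 and row q has 0.
   The columns before l are unchanged, and column l decreases since the 1 moves
   to a less significant position; so c(A) decreases.  Part (b) is the same for
   the transposed matrix: there the new factor is inserted next to A instead of
   at the outer end, which amounts to an outer multiplication by a conjugate,
   again a transposition. *)
Require Import Defs.
From mathcomp Require Import all_boot all_order all_fingroup all_algebra.
Import Order.TTheory GRing.Theory.
Local Open Scope ring_scope.

(** Passing to an interval of naturals exposes the first factor; [op] need not commute, as matrix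
    products require. *)
Lemma big_ord_geq_recl (R : Type) (idx : R) (op : Monoid.law idx) (n : nat)
    (F : 'I_n -> R) (k : 'I_n) :
  \big[op/idx]_(i < n | (k <= i)%N) F i =
  op (F k) (\big[op/idx]_(i < n | (k < i)%N) F i).
Proof.
(* [G] extends [F] to all naturals; the default [idx] is taken only from [n] on. *)
pose G j := oapp F idx (insub j).
have GE (i : 'I_n) : G i = F i by rewrite /G valK.
have tailE j : \big[op/idx]_(i < n | (j <= i)%N) F i =
    \big[op/idx]_(j <= i < n) G i.
  by rewrite big_geq_mkord; apply: eq_bigr => i _; rewrite GE.
by rewrite !tailE big_ltn // GE.
Qed.

Lemma bin_value_recl (k : nat) (a : 'I_k.+1 -> nat) :
  bin_value a = (a ord0 * 2 ^ k + bin_value (fun i => a (lift ord0 i)))%N.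
Proof. by rewrite /bin_value big_ord_recl subSS subn0. Qed.

Lemma bin_value_bound (k : nat) (a : 'I_k -> nat) :
  (forall i, a i <= 1)%N -> (bin_value a < 2 ^ k)%N.
Proof.
elim: k a => [|k IH] a a1; first by rewrite /bin_value big_ord0.
rewrite bin_value_recl expnS mul2n -addnn -addnS leq_add ?IH //.
by rewrite -[leqRHS]mul1n leq_mul2r a1 orbT.
Qed.

(** The digits of [a] after position [l] together weigh less than one unit at [l], by
    [bin_value_bound]. *)
Lemma bin_value_lt (k : nat) (a b : 'I_k -> nat) (l : 'I_k) :
  (forall i, a i <= 1)%N ->
  (forall i : 'I_k, (i < l)%N -> a i = b i) -> (a l < b l)%N ->
  (bin_value a < bin_value b)%N.
Proof.
elim: k a b l => [|k IH] a b l a1 eq_ab lt_ab; first by case: l {eq_ab lt_ab}.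
rewrite !bin_value_recl; case: (unliftP ord0 l) => [j|] def_l; last first.
  rewrite def_l in lt_ab; apply: leq_trans (leq_addr _ _).
  apply: (@leq_trans ((a ord0).+1 * 2 ^ k)); last by rewrite leq_mul2r lt_ab orbT.
  by rewrite mulSn addnC ltn_add2r bin_value_bound.
rewrite eq_ab ?def_l // ltn_add2l (IH _ _ j) -?def_l // => i lt_ij.
by rewrite eq_ab // def_l !lift0.
Qed.

(** Digit tuples are totally ordered lexicographically; [bin_value_lt] excludes that [b] comes
    first, and equal tuples have equal values. *)
Lemma bin_value_ltP (k : nat) (a b : 'I_k -> nat) :
  (forall i, b i <= 1)%N -> (bin_value a < bin_value b)%N ->
  exists2 l : 'I_k, forall i : 'I_k, (i < l)%N -> a i = b i & (a l < b l)%N.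
Proof.
move=> b1 lt_ab.
pose ta : k.-tuplelexi nat := [tuple a i | i < k].
pose tb : k.-tuplelexi nat := [tuple b i | i < k].
have [/ltxi_tuplePlt [l eqt ltt]|/ltxi_tuplePlt [l eqt ltt]|eqt] := ltgtP ta tb.
- exists l => [i /eqt|]; first by rewrite !tnth_mktuple.
  by move: ltt; rewrite !tnth_mktuple ltEnat.
- suff: (bin_value b < bin_value a)%N by rewrite ltnNge ltnW.
  apply: (@bin_value_lt _ _ _ l) => // [i /eqt|]; first by rewrite !tnth_mktuple.
  by move: ltt; rewrite !tnth_mktuple ltEnat.
- suff eq_ab : bin_value a = bin_value b by rewrite eq_ab ltnn in lt_ab.
  apply: eq_bigr => i _; congr (_ * _)%N.
  by have := congr1 (fun t => tnth t i) eqt; rewrite !tnth_mktuple.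
Qed.

Lemma binary_mx_le1 (n m : nat) (A : 'M[nat]_(n, m)) :
  binary_mx A -> forall i j, (A i j <= 1)%N.
Proof. by move=> hA i j; case: (hA i j) => ->. Qed.

Lemma binary_mx_tr (n m : nat) (A : 'M[nat]_(n, m)) :
  binary_mx A -> binary_mx A^T.
Proof. by move=> hA i j; rewrite mxE. Qed.

Lemma binary_mx_perm_mull (n m : nat) (P : 'M[nat]_n) (A : 'M[nat]_(n, m)) :
  is_perm_mx P -> binary_mx A -> binary_mx (P *m A).
Proof. by case/is_perm_mxP => s -> hA i j; rewrite -row_permE mxE. Qed.

Lemma row_code_tr (n m : nat) (A : 'M[nat]_(n, m)) : row_code A^T = col_code A.
Proof.
apply: eq_from_tnth => i; rewrite !tnth_mktuple.
by apply: eq_bigr => j _; rewrite mxE.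
Qed.

Lemma col_code_tr (n m : nat) (A : 'M[nat]_(n, m)) : col_code A^T = row_code A.
Proof. by rewrite -row_code_tr trmxK. Qed.

Lemma col_code_tperm_lt (n m : nat) (A : 'M[nat]_(n, m)) (i j : 'I_n) :
  binary_mx A ->
  (row_code (tperm_mx i j *m A) < row_code A)%O ->
  (col_code (tperm_mx i j *m A) < col_code A)%O.
Proof.
move=> /binary_mx_le1 A1; rewrite -xrowE.
case/ltxi_tuplePlt => p eq_row; rewrite !tnth_mktuple ltEnat /= => lt_row.
pose q := tperm i j p.
have bin_xrow r :
    bin_value (fun l => xrow i j A r l) = bin_value (fun l => A (tperm i j r) l).
  by apply: eq_bigr => l _; rewrite mxE.
rewrite bin_xrow -/q in lt_row.
have neq_pq : p != q by apply: contraTneq lt_row => <-; rewrite ltnn.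
(* The codes differ at [p], so [p] is one of the swapped rows and [q] the other. *)
have tpE : tperm i j = tperm p q.
  move: neq_pq; rewrite /q; case: tpermP => [->|->|_ _] //.
    by rewrite tpermC.
  by rewrite eqxx.
(* Were [q] before [p], the codes would agree at [q], where the swapped matrix carries row [p]; rows
   [p] and [q] would then have equal values. *)
have lt_pq : (p < q)%N.
  rewrite ltnNge leq_eqVlt negb_or eq_sym neq_pq; apply/negP => /eq_row.
  by rewrite !tnth_mktuple bin_xrow tpE tpermR => eq_pq; rewrite eq_pq ltnn in lt_row.
have [l eq_pq lt_l] := bin_value_ltP _ _ _ (A1 p) lt_row.
apply/ltxi_tuplePlt; exists l => [r lt_rl|]; rewrite !tnth_mktuple.
  apply: eq_bigr => k _; rewrite mxE tpE.
  by case: tpermP => // ->; rewrite eq_pq.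
(* In column [l] the digits above [p] stay fixed because [p < q], so [p] is the first digit to
   change. *)
rewrite ltEnat; apply: (@bin_value_lt _ _ _ p) => [k|k lt_kp|]; first by rewrite mxE.
  rewrite mxE tpE tpermD //; first by rewrite -val_eqE neq_ltn lt_kp orbT.
  by rewrite -val_eqE neq_ltn (ltn_trans lt_kp lt_pq) orbT.
by rewrite mxE.
Qed.

Lemma is_perm_mx_prod_tperm (n s : nat) (X : 'I_s -> 'M[nat]_n) (P : pred 'I_s) :
  (forall k, is_transposition_mx (X k)) -> is_perm_mx (\prod_(i < s | P i) X i).
Proof.
move=> hX; elim/big_ind: _ => [|Q R hQ hR|k _]; first exact: is_perm_mx1.
  by rewrite -mulmxE is_perm_mxMr.
by have [i [j [_ ->]]] := hX k; apply/is_perm_mxP; exists (tperm i j).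
Qed.

Lemma lt_chain (d : Order.disp_t) (T : porderType d) (f : nat -> T) (s : nat) :
  (0 < s)%N -> (forall k : 'I_s, (f k < f k.+1)%O) -> (f 0%N < f s)%O.
Proof.
move=> s_gt0 ltf.
have: {in [pred k | (k <= s)%N], forall k, k.+1 \in [pred k | (k <= s)%N] ->
    (f k < f k.+1)%O}.
  by move=> k _ lt_ks; apply: (ltf (Ordinal lt_ks)).
move/Order.NatMonotonyTheory.homo_ltn_lt_in; apply=> //; last exact: leqnn.
(* The monotonicity lemma asks that the domain of all [k <= s] be convex. *)
move=> i j _ le_js k /andP[_ lt_kj].
by apply: leq_trans le_js; apply: ltnW.
Qed.

Lemma col_code_chain_lt (n m : nat) (A : 'M[nat]_(n, m)) (s : nat)
    (X : 'I_s -> 'M[nat]_n) :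
  binary_mx A -> (0 < s)%N ->
  (forall k, is_transposition_mx (X k)) ->
  (forall k : 'I_s,
     (row_code ((\prod_(i < s | (k <= i)%N) X i) *m A) <
      row_code ((\prod_(i < s | (k < i)%N) X i) *m A))%O) ->
  (col_code ((\prod_(i < s) X i) *m A) < col_code A)%O.
Proof.
move=> hA s_gt0 hX lt_row.
(* [f 0] has the full product and [f s] the empty one; going from [f k.+1] to [f k] multiplies on
   the left by [X k]. *)
pose f k := col_code ((\prod_(i < s | (k <= i)%N) X i) *m A).
have <- : f s = col_code A.
  by rewrite /f big_pred0 ?mul1mx // => i; rewrite leqNgt ltn_ord.
apply: (@lt_chain _ _ f) => // k; move: (lt_row k).
rewrite /f big_ord_geq_recl /= -mulmxE -mulmxA.
have [i [j [_ ->]]] := hX k; apply: col_code_tperm_lt.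
by apply: binary_mx_perm_mull hA; apply: is_perm_mx_prod_tperm.
Qed.

(** Conjugation by [s] moves a factor standing next to [A] past the tail product, to the outer right
    end. *)
Lemma tperm_mx_mulr_perm (n : nat) (i j : 'I_n) (s : {perm 'I_n}) :
  tperm_mx i j *m perm_mx s = perm_mx s *m tperm_mx (s i) (s j) :> 'M[nat]_n.
Proof. by rewrite /tperm_mx -!perm_mxM -tpermJ conjgE !mulgA mulgV mul1g. Qed.

Lemma row_code_chain_lt (n m : nat) (A : 'M[nat]_(n, m)) (t : nat)
    (Y : 'I_t -> 'M[nat]_m) :
  binary_mx A -> (0 < t)%N ->
  (forall k, is_transposition_mx (Y k)) ->
  (forall k : 'I_t,
     (col_code (A *m (\prod_(i < t | (k <= i)%N) Y i)) <
      col_code (A *m (\prod_(i < t | (k < i)%N) Y i)))%O) ->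
  (row_code (A *m (\prod_(i < t) Y i)) < row_code A)%O.
Proof.
move=> hA t_gt0 hY lt_col.
pose f k := row_code (A *m (\prod_(i < t | (k <= i)%N) Y i)).
have <- : f t = row_code A.
  by rewrite /f big_pred0 ?mulmx1 // => i; rewrite leqNgt ltn_ord.
apply: (@lt_chain _ _ f) => // k; move: (lt_col k).
rewrite /f big_ord_geq_recl /= -mulmxE.
have [i [j [_ ->]]] := hY k.
have /is_perm_mxP[s ->] := is_perm_mx_prod_tperm _ _ _ (fun i => (k < i)%N) hY.
rewrite tperm_mx_mulr_perm mulmxA -!row_code_tr => lt_row; rewrite -!col_code_tr.
(* Transposing turns the outer right factor into a left one. *)
move: lt_row; rewrite trmx_mul tr_tperm_mx; apply: col_code_tperm_lt.
rewrite trmx_mul; apply: binary_mx_perm_mull (binary_mx_tr _ _ _ hA).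
by rewrite is_perm_mx_tr; apply/is_perm_mxP; exists s.
Qed.

Theorem theorem1 (n m : nat) (hn : (0 < n)%N) (hm : (0 < m)%N)
    (A : 'M[nat]_(n, m)) (hA : binary_mx A) :
  (forall (s : nat) (X : 'I_s -> 'M[nat]_n),
      (1 <= s)%N ->
      (forall k : 'I_s, is_transposition_mx (X k)) ->
      (forall k : 'I_s,
          (row_code ((\prod_(i < s | (k <= i)%N) X i) *m A) <
           row_code ((\prod_(i < s | (k < i)%N) X i) *m A))%O) ->
      (col_code ((\prod_(i < s) X i) *m A) < col_code A)%O)
  /\
  (forall (t : nat) (Y : 'I_t -> 'M[nat]_m),
      (1 <= t)%N ->
      (forall k : 'I_t, is_transposition_mx (Y k)) ->
      (forall k : 'I_t,
          (col_code (A *m (\prod_(i < t | (k <= i)%N) Y i)) <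
           col_code (A *m (\prod_(i < t | (k < i)%N) Y i)))%O) ->
      (row_code (A *m (\prod_(i < t) Y i)) < row_code A)%O).
Proof.
split=> [s X|t Y]; first exact: col_code_chain_lt.
exact: row_code_chain_lt.
Qed.
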